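(* Let $R$ be a ring, let $M_R$ be an injective right $R$-module, and let $S=\mathrm{End}(M_R)$ be the endomorphism ring of $M_R$. If $M_R$ is square-free, then every left ideal of $S$ containing the Jacobson radical $J(S)$ of $S$ is a two-sided ideal. In particular, if $M_R$ is square-free, then $S$ is left quasi-duo.
   Context: Rings are associative with identity (not necessarily commutative) and modules are right modules. Endomorphisms of $M_R$ are written on the left, so multiplication in $\mathrm{End}(M_R)$ is composition $(fg)(x)=f(g(x))$. An injective module $M_R$ is called square-free if it contains no direct summand isomorphic to $X\oplus X$ for some nonzero direct summand $X$ of $M_R$; i.e. there is no direct summand $X\neq 0$ of $M_R$ such that $X\oplus X$ is isomorphic to a direct summand of $M_R$. A ring $S$ is called left quasi-duo if every maximal left ideal of $S$ is a two-sided ideal. *)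

(* Defs.v *)
From HB Require Import structures.
From mathcomp Require Import all_boot all_algebra.
From mathcomp Require Import boolp classical_sets.

Set Implicit Arguments.
Unset Strict Implicit.
Unset Printing Implicit Defensive.

Import GRing.Theory.
Local Open Scope classical_set_scope.
Local Open Scope ring_scope.

(* Rings are [pzRingType]s: associative with identity, possibly zero, so that
   the endomorphism ring of the zero module is included.  The library only has
   left modules, so a right module over [R] is a left module over the converse
   ring [R^c]. *)

Section Endomorphisms.
Variables (A : pzRingType) (M : lmodType A).

Definition endo : Type := {linear M -> M}.

HB.instance Definition _ := gen_eqMixin endo.
HB.instance Definition _ := gen_choiceMixin endo.

Implicit Types f g h : endo.

Lemma endoP f g : f =1 g -> f = g.
Proof.
case: f g => [f [[fD] [fZ]]] [g [[gD] [gZ]]] /= /funext fg.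
by case: g / fg in gD gZ *; congr (GRing.Linear.Pack (GRing.Linear.Class _ _));
  congr (_ _); exact: Prop_irrelevance.
Qed.

Definition endo_zero : endo := \0.
Definition endo_one : endo := idfun.
Definition endo_opp f : endo := \- f.
Definition endo_add f g : endo := f \+ g.
Definition endo_mul f g : endo := f \o g.

Fact endo_addA : associative endo_add.
Proof. by move=> f g h; apply: endoP => x /=; rewrite addrA. Qed.
Fact endo_addC : commutative endo_add.
Proof. by move=> f g; apply: endoP => x /=; rewrite addrC. Qed.
Fact endo_add0 : left_id endo_zero endo_add.
Proof. by move=> f; apply: endoP => x /=; rewrite add0r. Qed.
Fact endo_addN : left_inverse endo_zero endo_opp endo_add.
Proof. by move=> f; apply: endoP => x /=; rewrite addNr. Qed.

HB.instance Definition _ :=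
  GRing.isZmodule.Build endo endo_addA endo_addC endo_add0 endo_addN.

Fact endo_mulA : associative endo_mul.
Proof. by move=> f g h; apply: endoP. Qed.
Fact endo_mul1l : left_id endo_one endo_mul.
Proof. by move=> f; apply: endoP. Qed.
Fact endo_mul1r : right_id endo_one endo_mul.
Proof. by move=> f; apply: endoP. Qed.
Fact endo_mulDl : left_distributive endo_mul endo_add.
Proof. by move=> f g h; apply: endoP. Qed.
Fact endo_mulDr : right_distributive endo_mul endo_add.
Proof. by move=> f g h; apply: endoP => x /=; rewrite raddfD. Qed.

HB.instance Definition _ := GRing.Zmodule_isPzRing.Build endo
  endo_mulA endo_mul1l endo_mul1r endo_mulDl endo_mulDr.

End Endomorphisms.

Section Submodules.
Variables (A : pzRingType) (M : lmodType A).

Section Sort.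
Variable X : submodClosed M.

Record submod_sort := SubmodSort {submod_val :> M; _ : submod_val \in X}.

HB.instance Definition _ := [isSub for submod_val].
HB.instance Definition _ := [Choice of submod_sort by <:].
HB.instance Definition _ := [SubChoice_isSubLmodule of submod_sort by <:].

End Sort.

Definition direct_summand (X : submodClosed M) : Prop :=
  exists Y : submodClosed M,
    (forall m, m \in X -> m \in Y -> m = 0) /\
    (forall m, exists x y, [/\ x \in X, y \in Y & m = x + y]).

End Submodules.

Section Modules.
Variable A : pzRingType.

Definition isomorphic (U V : lmodType A) : Prop :=
  exists f : {linear U -> V}, bijective f.

Definition injective_module (M : lmodType A) : Prop :=
  forall (U V : lmodType A) (i : {linear U -> V}) (f : {linear U -> M}),
    injective i -> exists g : {linear V -> M}, forall u, g (i u) = f u.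

Definition square_free (M : lmodType A) : Prop :=
  ~ exists X Z : submodClosed M,
      [/\ direct_summand X, exists2 x, x \in X & x != 0, direct_summand Z
        & isomorphic (submod_sort X * submod_sort X)%type (submod_sort Z)].

End Modules.

Section Ideals.
Variable S : pzRingType.
Implicit Types I K : set S.

Definition left_ideal I : Prop :=
  [/\ I 0, forall x y, I x -> I y -> I (x + y) & forall a x, I x -> I (a * x)].

Definition two_sided_ideal I : Prop :=
  left_ideal I /\ forall a x, I x -> I (x * a).

Definition maximal_left_ideal I : Prop :=
  [/\ left_ideal I, I <> [set: S]
    & forall K, left_ideal K -> I `<=` K -> K = I \/ K = [set: S]].

End Ideals.

Definition jacobson_radical (S : pzRingType) : set S :=
  \bigcap_(I in @maximal_left_ideal S) I.
Arguments jacobson_radical S : clear implicits.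

Definition left_quasi_duo (S : pzRingType) : Prop :=
  forall I : set S, maximal_left_ideal I -> two_sided_ideal I.

(* Main.v *)
(** The engine is a consequence of square-freeness: if [N] is a submodule of
    the square-free injective module [M], [f] an endomorphism, and [f n] lies
    in [N] for no nonzero [n] in [N], then [N = 0].  Indeed a maximal essential
    extension [X] of [N] in [M] is a direct summand, [f] still satisfies this
    condition on [X], hence [(x, y) |-> x + f y] embeds [X * X] in [M], with an
    image that splits off because [X * X] is injective.

    Given endomorphisms [f] and [h], apply this to submodules of [K = ker h]:
    the set [K'] of the [k] in [K] such that [f k] is in [K] is essential in
    [K].  Let [L] be a complement of [K].  As [h] is injective on [L], some [s]
    satisfies [s (h l) = h (f l)] on [L], so [h f - s h] vanishes on the
    essential submodule [L + K'], and thus lies in [J(S)].  Hence [h f] is in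
    [S h + J(S)]. *)

From HB Require Import structures.
Require Import Defs.
From mathcomp Require Import all_boot all_algebra.
From mathcomp Require Import boolp classical_sets.

Set Implicit Arguments.
Unset Strict Implicit.
Unset Printing Implicit Defensive.

Import GRing.Theory.
Local Open Scope classical_set_scope.
Local Open Scope ring_scope.

(** * Submodules as sets, and their sums and intersections *)

Section Submodules.
Variables (A : pzRingType) (M : lmodType A).
Implicit Types (N X C B : set M) (f g h s : {linear M -> M}).

Definition submodule N : Prop :=
  [/\ N 0, forall x y, N x -> N y -> N (x + y)
    & forall a x, N x -> N (a *: x)].

Definition essential N : Prop :=
  forall B, submodule B -> N `&` B `<=` [set 0] -> B `<=` [set 0].

Lemma submoduleN N x : submodule N -> N x -> N (- x).
Proof. by case=> _ _ NZ Nx; rewrite -scaleN1r; apply: NZ. Qed.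

Lemma submoduleB N x y : submodule N -> N x -> N y -> N (x - y).
Proof. by move=> Nsub Nx Ny; have [_ ND _] := Nsub; apply: ND => //; apply: submoduleN. Qed.

Lemma submodule0 : submodule [set 0].
Proof.
by split=> [|x y -> ->|a x ->] /=; rewrite ?addr0 ?scaler0.
Qed.

Lemma submoduleI N C : submodule N -> submodule C -> submodule (N `&` C).
Proof.
case=> N0 ND NZ [C0 CD CZ]; split=> //.
- by move=> x y [Nx Cx] [Ny Cy]; split; [apply: ND|apply: CD].
- by move=> a x [Nx Cx]; split; [apply: NZ|apply: CZ].
Qed.

Lemma submodule_preimage f N : submodule N -> submodule (f @^-1` N).
Proof.
case=> N0 ND NZ; split; rewrite /preimage /=.
- by rewrite linear0.
- by move=> x y Nx Ny; rewrite linearD; apply: ND.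
- by move=> a x Nx; rewrite linearZ; apply: NZ.
Qed.

Lemma submodule_image f N : submodule N -> submodule (f @` N).
Proof.
case=> N0 ND NZ; split.
- by exists 0; rewrite ?linear0.
- move=> _ _ [x Nx <-] [y Ny <-].
  by exists (x + y); rewrite ?linearD //; apply: ND.
- by move=> a _ [x Nx <-]; exists (a *: x); rewrite ?linearZ //; apply: NZ.
Qed.

Lemma submodule_sum N C : submodule N -> submodule C ->
  submodule [set z | exists x y, [/\ N x, C y & z = x + y]].
Proof.
case=> N0 ND NZ [C0 CD CZ]; split.
- by exists 0, 0; rewrite addr0.
- move=> _ _ [x [y [Nx Cy ->]]] [x' [y' [Nx' Cy' ->]]].
  by exists (x + x'), (y + y'); split; rewrite 1?addrACA //; [apply: ND|apply: CD].
- move=> a _ [x [y [Nx Cy ->]]].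
  by exists (a *: x), (a *: y); split; rewrite ?scalerDr //; [apply: NZ|apply: CZ].
Qed.

(** Passes from sets to the bundled submodules in which square-freeness is stated and from which
    maps into [M] are extended. *)
Lemma submodule_submodClosed N : submodule N ->
  exists X : submodClosed M, forall x, (x \in X) <-> N x.
Proof.
case=> N0 ND NZ; pose P : M -> bool := fun x => `[< N x >].
have Pclosed : GRing.subsemimod_closed P.
  split; last by move=> a x /asboolP Nx; apply/asboolP/NZ.
  split; first exact/asboolP.
  by move=> x y /asboolP Nx /asboolP Ny; apply/asboolP/ND.
pose mix := GRing.isSubmodClosed.Build A M P Pclosed.
pose X : submodClosed M := HB.pack_for (submodClosed M) P mix.
by exists X => x; split=> /asboolP.
Qed.

(** Zorn's lemma: the union of a chain of submodules over [N] meeting [C] trivially is again one. *)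
Lemma maximal_disjoint N C : submodule N -> N `&` C `<=` [set 0] ->
  exists X, [/\ submodule X, N `<=` X, X `&` C `<=` [set 0]
    & forall B, submodule B -> X `<=` B -> B `&` C `<=` [set 0] -> B `<=` X].
Proof.
move=> Nsub NC.
(* Adjoining [N] makes the union of the empty chain admissible. *)
pose P X := submodule (X `|` N) /\ (X `|` N) `&` C `<=` [set 0].
have Pbigcup (F : set (set M)) : F `<=` P -> total_on F subset ->
    P (\bigcup_(X in F) X).
  move=> FP Ftot; have [N0 ND NZ] := Nsub; split; last first.
    move=> x [[[X FX Xx]|Nx] Cx]; last by apply: NC.
    by have [_] := FP _ FX; apply; split; [left|].
  split; first by right.
  - have XD X x y : F X -> (X `|` N) x -> (X `|` N) y ->
        (\bigcup_(X in F) X `|` N) (x + y).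
      move=> FX Xx Xy; have [[_ XD _] _] := FP _ FX.
      by have [Xxy|Nxy] := XD _ _ Xx Xy; [left; exists X|right].
    move=> x y [[X FX Xx]|Nx] [[Y FY Yy]|Ny].
    + case: (Ftot _ _ FX FY) => [XY|YX].
      * by apply: (XD Y) => //; left=> //; apply: XY.
      * by apply: (XD X) => //; left=> //; apply: YX.
    + by apply: (XD X) => //; [left|right].
    + by apply: (XD Y) => //; [right|left].
    + by right; apply: ND.
  - move=> a x [[X FX Xx]|Nx]; last by right; apply: NZ.
    have [[_ _ XZ] _] := FP _ FX.
    by have [|Xax|Nax] := XZ a x; [left|left; exists X|right].
have [X [[Xsub XC] Xmax]] := @Zorn_bigcup M P Pbigcup.
exists (X `|` N); split=> // B Bsub XB BC x Bx; left.
have BN : B `|` N = B by apply/setUidPl => y Ny; apply: XB; right.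
apply: contrapT => nXx; apply: (Xmax B); last by rewrite /P BN.
by split=> [y Xy|/(_ _ Bx)]; [apply: XB; left|].
Qed.

(** If [c + b = n], then [b = n - c] lies in [N + C] and in [B], so it vanishes, and [c = n]
    vanishes in turn. *)
Lemma sum_disjoint N C B : submodule N -> submodule C ->
  N `&` C `<=` [set 0] ->
  [set z | exists x y, [/\ N x, C y & z = x + y]] `&` B `<=` [set 0] ->
  [set z | exists x y, [/\ C x, B y & z = x + y]] `&` N `<=` [set 0].
Proof.
move=> Nsub Csub NC NCB z [[c [b [Cc Bb def_z]]] Nz] /=.
have def_b : b = z - c by rewrite def_z addrAC subrr add0r.
have b0 : b = 0.
  by apply: NCB; split=> //; exists z, (- c); split=> //; apply: submoduleN.
by apply: NC; split=> //; rewrite def_z b0 addr0.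
Qed.

(** * Extension of maps into an injective module *)

Section Injective.
Hypothesis injM : injective_module M.

Lemma extend_on_submodule N h f : submodule N ->
    (forall x, N x -> h x = 0 -> x = 0) ->
  exists s, forall x, N x -> s (h x) = f x.
Proof.
move=> Nsub hinj; have [X XP] := submodule_submodClosed Nsub.
pose hX : {linear submod_sort X -> M} := h \o (val : submod_sort X -> M).
pose fX : {linear submod_sort X -> M} := f \o (val : submod_sort X -> M).
have hXinj : injective hX.
  apply: raddf_inj => x hx0; apply: val_inj; rewrite linear0.
  by apply: hinj => //; apply/XP/valP.
have [s sP] := @injM _ _ _ fX hXinj.
exists s => x /XP Xx; exact: (sP (SubmodSort Xx)).
Qed.

(** Addition embeds [X * C] in [M], and the first projection extends along it. Nothing yet forces
    the range of [g] into [X]. *)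
Lemma extend_projection X C : submodule X -> submodule C ->
    X `&` C `<=` [set 0] ->
  exists g, (forall x, X x -> g x = x) /\ (forall x, C x -> g x = 0).
Proof.
move=> /[dup] Xsub /submodule_submodClosed[X' XP].
move=> /[dup] Csub /submodule_submodClosed[C' CP] XC.
pose vX : {linear submod_sort X' -> M} := (val : submod_sort X' -> M).
pose vC : {linear submod_sort C' -> M} := (val : submod_sort C' -> M).
pose i : {linear (submod_sort X' * submod_sort C')%type -> M} :=
  (vX \o fst) \+ (vC \o snd).
pose p : {linear (submod_sort X' * submod_sort C')%type -> M} := vX \o fst.
have iinj : injective i.
  apply: raddf_inj => u iu0; have u0 : vX u.1 + vC u.2 = 0 := iu0.
  have X1 : X (vX u.1) by apply/XP/valP.
  have C2 : C (vC u.2) by apply/CP/valP.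
  have v1 : vX u.1 = 0.
    apply: XC; split=> //; move/eqP: u0; rewrite addr_eq0 => /eqP ->.
    exact: submoduleN.
  move: u0; rewrite v1 add0r => v2.
  have e1 : u.1 = 0 by apply: val_inj; rewrite linear0.
  have e2 : u.2 = 0 by apply: val_inj; rewrite linear0.
  by rewrite [LHS]surjective_pairing e1 e2.
have [g gP] := @injM _ _ _ p iinj.
exists g; split=> [x /XP Xx|x /CP Cx].
- by have /= := gP (SubmodSort Xx, 0); rewrite addr0.
- by have /= := gP (0, SubmodSort Cx); rewrite add0r.
Qed.

(* The maximal essential extension is obtained as a complement of a
   complement. *)
Lemma essential_summand N : submodule N ->
  exists X g, [/\ submodule X, N `<=` X,
    forall B, submodule B -> B `<=` X -> B `&` N `<=` [set 0] -> B `<=` [set 0],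
    forall x, X x -> g x = x & forall x, X (g x)].
Proof.
move=> Nsub; have Z : [set (0 : M)] `&` N `<=` [set 0] by move=> x [].
have [C [Csub _ CN Cmax]] := maximal_disjoint submodule0 Z.
have NC : N `&` C `<=` [set 0] by rewrite setIC.
have [X [Xsub NX XC Xmax]] := maximal_disjoint Nsub NC.
have ess B : submodule B -> B `<=` X -> B `&` N `<=` [set 0] ->
    B `<=` [set 0].
  move=> Bsub BX BN b Bb.
  (* [C + B] still meets [N] trivially, so maximality of [C] puts [B] inside [C], hence inside [X]
     and [C] at once. *)
  pose D := [set z | exists x y, [/\ C x, B y & z = x + y]].
  apply: (XC); split; first exact: BX.
  apply: (Cmax D); first exact: submodule_sum.
  - by move=> c Cc; exists c, 0; case: Bsub => B0 _ _; rewrite addr0.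
  - apply: (sum_disjoint Nsub) => // z [[n [c [Nn Cc def_z]]] Bz] /=.
    have c0 : c = 0.
      apply: XC; split=> //.
      have -> : c = z - n by rewrite def_z addrAC subrr add0r.
      by apply: submoduleB => //; [apply: BX|apply: NX].
    by apply: BN; split=> //; rewrite def_z c0 addr0.
  - by exists 0, b; case: Csub => C0 _ _; rewrite add0r.
have [g [gX gC]] := extend_projection Xsub Csub XC.
exists X, g; split=> // m.
have Tsub : submodule [set: M] by split.
have Gsub := submodule_image g Tsub.
(* The range of [g] contains [X]; by maximality it lies in [X] once it meets [C] trivially. *)
apply: (Xmax (g @` [set: M])) => //.
  by move=> x Xx; exists x; rewrite ?gX.
move=> _ [[x _ <-] Cgx] /=.
(* This preimage contains [C] and meets [N] trivially, since [g] fixes [N]. So it lies in [C], where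
   [g] vanishes. *)
have Psub : submodule (g @^-1` ((g @` [set: M]) `&` C)).
  exact/submodule_preimage/submoduleI.
have PC : g @^-1` ((g @` [set: M]) `&` C) `<=` C.
  apply: Cmax => //.
    move=> c Cc; rewrite /preimage /= gC //.
    by case: Gsub => G0 _ _; case: Csub.
  move=> n [[_ Cgn] Nn]; apply: NC; split=> //.
  by rewrite gX // in Cgn; apply: NX.
by apply: gC; apply: PC; split=> //; exists x.
Qed.

(** * Consequences of square-freeness *)

Section SquareFree.
Hypothesis sqfM : square_free M.

Lemma square_free_disjoint_image N f : submodule N ->
  (forall n, N n -> N (f n) -> n = 0) -> N `<=` [set 0].
Proof.
move=> Nsub Nf.
have [X [g [Xsub NX ess gX Xg]]] := essential_summand Nsub.
have Xf x : X x -> X (f x) -> x = 0.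
  have Bsub : submodule (X `&` f @^-1` X).
    by apply: submoduleI => //; apply: submodule_preimage.
  move=> Xx Xfx; apply: (ess _ Bsub) => //.
  move=> n [[Xn Xfn] Nn] /=; apply: (Nf) => //.
  (* The image under [f] of the part of [N] sent into [X] is a submodule of [X] meeting [N]
     trivially, so it is zero. *)
  suff -> : f n = 0 by case: Nsub.
  have Isub : submodule (f @` (N `&` f @^-1` X)).
    by apply/submodule_image/submoduleI => //; apply: submodule_preimage.
  apply: (ess _ Isub); last by exists n.
    by move=> _ [y [_ ?] <-].
  move=> _ [[y [Ny _] <-] Nfy] /=.
  by rewrite (Nf y) ?linear0.
have [X' XP] := submodule_submodClosed Xsub.
pose vX : {linear submod_sort X' -> M} := (val : submod_sort X' -> M).
pose i : {linear (submod_sort X' * submod_sort X')%type -> M} :=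
  (vX \o fst) \+ ((f \o vX) \o snd).
have iinj : injective i.
  apply: raddf_inj => u iu0; have u0 : vX u.1 + f (vX u.2) = 0 := iu0.
  have X1 : X (vX u.1) by apply/XP/valP.
  have X2 : X (vX u.2) by apply/XP/valP.
  have v2 : vX u.2 = 0.
    apply: Xf => //; move/eqP: u0; rewrite addrC addr_eq0 => /eqP ->.
    exact: submoduleN.
  move: u0; rewrite v2 linear0 addr0 => v1.
  have e1 : u.1 = 0 by apply: val_inj; rewrite linear0.
  have e2 : u.2 = 0 by apply: val_inj; rewrite linear0.
  by rewrite [LHS]surjective_pairing e1 e2.
(* [g1] and [g2] recover the coordinates of [i u]; elsewhere their values may leave [X], and [g]
   brings them back. *)
have [g1 g1P] := @injM _ _ _ (vX \o fst) iinj.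
have [g2 g2P] := @injM _ _ _ (vX \o snd) iinj.
(* [i u = vX u.1 + f (vX u.2)], so [r] is idempotent with the image of [i]
   as range. *)
pose r : {linear M -> M} := (g \o g1) \+ (f \o g \o g2).
have ri u : r (i u) = i u.
  rewrite -[LHS]/(g (g1 (i u)) + f (g (g2 (i u)))) g1P g2P /= !gX //; exact/XP/valP.
have rE m : exists u, r m = i u.
  have X1 : g (g1 m) \in X' by apply/XP.
  have X2 : g (g2 m) \in X' by apply/XP.
  by exists (SubmodSort X1, SubmodSort X2).
have Tsub : submodule [set: M] by split.
have [Z ZP] := submodule_submodClosed (submodule_image r Tsub).
have [K KP] :=
  submodule_submodClosed (submodule_preimage r submodule0).
have [G GP] := submodule_submodClosed (submodule_preimage g submodule0).
(* The range of an idempotent is a summand, with its kernel as complement; this serves for both [g]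
   and [r]. *)
have summand (q : {linear M -> M}) (U V : submodClosed M) :
    (forall x, x \in U -> q x = x) -> (forall x, q x \in U) ->
    (forall x, (x \in V) <-> q x = 0) -> direct_summand U.
  move=> qU Uq VP; exists V; split=> [m Um /VP <-|m]; first by rewrite qU.
  exists (q m), (m - q m); split=> //; last by rewrite addrC subrK.
  by apply/VP; rewrite linearB (qU (q m)) ?subrr.
have rr m : r (r m) = r m by have [u ->] := rE m; apply: ri.
move=> n Nn /=; apply: contrapT => n0; apply: sqfM; exists X', Z; split.
- apply: (summand g _ G) => //; first by move=> x /XP; apply: gX.
  by move=> x; apply/XP.
- by exists n; [apply/XP/NX|apply/eqP].
- apply: (summand r _ K) => //; first by move=> x /ZP [y _ <-].
  by move=> x; apply/ZP; exists x.
- have Zi u : i u \in Z by apply/ZP; exists (i u).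
  pose j (u : (submod_sort X' * submod_sort X')%type) : submod_sort Z :=
    SubmodSort (Zi u).
  have jlin : linear j by move=> a u v; apply: val_inj; exact: (linearP i).
  pose mix := GRing.isLinear.Build _ _ _ _ j jlin.
  pose J : {linear (submod_sort X' * submod_sort X')%type -> submod_sort Z} :=
    HB.pack_for {linear (submod_sort X' * submod_sort X')%type -> submod_sort Z}
      j mix.
  exists J.
  have jsurj (z : submod_sort Z) : exists u, j u = z.
    have /ZP [m _ rm] := valP z; have [u ru] := rE m.
    by exists u; apply: val_inj; rewrite /= -[RHS]rm ru.
  have [k kP] := choice jsurj.
  exists k => [u|z]; last exact: kP.
  by apply: iinj; have /(congr1 val) := kP (j u).
Qed.

Lemma commute_up_to_essential f h :
  exists s, essential [set m | h (f m) = s (h m)].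
Proof.
pose K := h @^-1` [set 0].
have Ksub : submodule K by apply/submodule_preimage/submodule0.
have [L [Lsub _ LK Lmax]] : exists L, [/\ submodule L, [set 0] `<=` L,
    L `&` K `<=` [set 0] & forall B, submodule B -> L `<=` B ->
    B `&` K `<=` [set 0] -> B `<=` L].
  by apply: maximal_disjoint submodule0 _ => x [].
have [s sP] : exists s, forall x, L x -> s (h x) = h (f x).
  apply: (extend_on_submodule (h \o f)) => // x Lx hx.
  by apply: LK.
exists s => B Bsub EB.
(* The projection to [K] of [B `&` (L + K)]. *)
pose N := K `&` [set k | exists2 l, L l & B (l + k)].
have [L0 LD LZ] := Lsub; have [B0 BD BZ] := Bsub; have [K0 KD KZ] := Ksub.
have Nsub : submodule N.
  split; first by split=> //; exists 0; rewrite ?addr0.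
  - move=> x y [Kx [l Ll Blx]] [Ky [l' Ll' Bly]]; split; first exact: KD.
    by exists (l + l'); [apply: LD|rewrite addrACA; apply: BD].
  - move=> a x [Kx [l Ll Blx]]; split; first exact: KZ.
    by exists (a *: l); [apply: LZ|rewrite -scalerDr; apply: BZ].
have N0 : N `<=` [set 0].
  (* When [k] and [f k] are in [K], both [h \o f] and [s \o h] ignore [k] and agree on [l], so
     [l + k] is zero and [k = - l] lies in [L]. *)
  apply: (@square_free_disjoint_image N f) => // k [Kk [l Ll Blk]] [Kfk _].
  have lk0 : l + k = 0.
    apply: EB; split=> //=.
    by rewrite !linearD /= sP // Kk Kfk linear0.
  apply: LK; split=> //; move/eqP: lk0; rewrite addrC addr_eq0 => /eqP ->.
  exact: submoduleN.
have LKB : [set z | exists x y, [/\ K x, L y & z = x + y]] `&` B `<=` [set 0].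
  move=> z [[k [l [Kk Ll def_z]]] Bz].
  have k0 : k = 0 by apply: N0; split=> //; exists l; rewrite // addrC -def_z.
  by apply: EB; split=> //=; rewrite def_z k0 add0r sP.
move=> b Bb; apply: EB; split=> //=; rewrite sP //.
(* [L + B] meets [K] trivially, so maximality of [L] gives that [B] lies in [L]. *)
apply: (Lmax [set z | exists x y, [/\ L x, B y & z = x + y]]).
- exact: submodule_sum.
- by move=> l Ll; exists l, 0; rewrite addr0.
- by apply: (sum_disjoint Ksub) => //; rewrite setIC.
- by exists 0, b; rewrite add0r.
Qed.

End SquareFree.

(** * Essential kernels and the Jacobson radical *)

(** If a maximal left ideal [I] missed [f], it would contain some [x = 1 - a * f]. This is the
    identity on the essential kernel of [f], hence injective, and a left inverse from injectivity of
    [M] puts [1] in [I]. *)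
Lemma essential_kernel_jacobson (f : endo M) :
  essential [set m | f m = 0] -> jacobson_radical (endo M) f.
Proof.
move=> ess I [Ilid InT Imax]; have [I0 ID IM] := Ilid.
apply: contrapT => nIf; apply: InT.
pose D : set (endo M) := [set z | exists x a, I x /\ z = x + a * f].
have Dlid : left_ideal D.
  split; first by exists 0, 0; rewrite mul0r addr0.
  - move=> _ _ [x [a [Ix ->]]] [y [b [Iy ->]]]; exists (x + y), (a + b).
    by split; [apply: ID|rewrite mulrDl addrACA].
  - move=> c _ [x [a [Ix ->]]]; exists (c * x), (c * a).
    by split; [apply: IM|rewrite mulrDr mulrA].
have ID' : I `<=` D by move=> x Ix; exists x, 0; rewrite mul0r addr0.
have [DI|DT] := Imax _ Dlid ID'.
  by case: nIf; rewrite -DI; exists 0, 1; rewrite add0r mul1r.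
have : D 1 by rewrite DT.
case=> x [a [Ix def1]].
have defx : x = 1 - a * f by rewrite def1 addrK.
pose xl : {linear M -> M} := x.
have Tsub : submodule [set: M] by split.
have xE m : x m = m - a (f m) by rewrite defx.
have xker m : [set: M] m -> xl m = 0 -> m = 0.
  move=> _; apply: (ess (xl @^-1` [set 0])).
    exact/submodule_preimage/submodule0.
  by move=> y [/= fy]; rewrite /preimage /= /xl xE fy linear0 subr0.
have [s sP] := extend_on_submodule idfun Tsub xker.
have s1 : (s : endo M) * x = 1 by apply: endoP => m; apply: sP.
have I1 : I 1 by rewrite -s1; apply: IM.
by apply/seteqP; split=> // y _; rewrite -[y]mulr1; apply: IM.
Qed.

End Injective.
End Submodules.

Theorem theorem2p8 (R : pzRingType) (M : lmodType R^c)
    (injM : injective_module M) (sqfM : square_free M) :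
  (forall I : set (endo M),
     left_ideal I -> jacobson_radical (endo M) `<=` I -> two_sided_ideal I)
  /\ left_quasi_duo (endo M).
Proof.
have two_sided (I : set (endo M)) : left_ideal I ->
    jacobson_radical (endo M) `<=` I -> two_sided_ideal I.
  move=> Ilid JI; split=> // f h Ih; have [_ ID IM] := Ilid.
  have [s ess] := commute_up_to_essential injM sqfM f h.
  (* Of the two summands, [h * f - s * h] has essential kernel, so it is in the radical, and [s * h]
     is in [I]. *)
  rewrite -[h * f](subrK ((s : endo M) * h)).
  apply: ID; last exact: IM.
  apply: JI; apply: (essential_kernel_jacobson injM) => B Bsub EB.
  apply: ess => //.
  move=> m [/= hfm Bm]; apply: EB; split=> //.
  by rewrite /= -[LHS]/(h (f m) - s (h m)) hfm subrr.
split=> // I Imax; apply: two_sided; first by case: Imax.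
by move=> f Jf; apply: Jf.
Qed.
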